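(* Let $\mathcal{L}\subseteq\mathbb{Z}^3$ be an order ideal with $\mathcal{L}\subseteq C(0,0,0)$ and $\mathcal{U}\cap C(0,0,0)$ finite, let $\mathcal{I}$ be as in the context, and suppose $r_a(i_0,j_0,k_0)\subseteq\mathcal{I}$ is a rhombus. Then for any cutoff $N$ for $\mathcal{I}$ and any $\mathcal{I}$-grove $G$ within radius $N$, $$\sum_{\substack{(i,j,k)\in\mathcal{I}\\ j<j_0,\ k<k_0}}\bigl(\deg_G(i,j,k)-2\bigr)$$ (a sum with only finitely many nonzero terms) equals $-1$ if the long edge $e_a(i_0,j_0,k_0)$ lies in $G$, and $0$ if it does not.
   Context: For $(i,j,k)\in\mathbb{Z}^3$ let $C(i,j,k)=\{(i',j',k') : i'\le i,\ j'\le j,\ k'\le k\}$. $\mathcal{L}\subseteq\mathbb{Z}^3$ satisfies: $(i,j,k)\in\mathcal{L}\Rightarrow C(i,j,k)\subseteq\mathcal{L}$. $\mathcal{U}=\mathbb{Z}^3\setminus\mathcal{L}$, $\mathcal{I}=\{(i,j,k)\in\mathcal{L} : (i+1,j+1,k+1)\in\mathcal{U}\}$. A cutoff for $\mathcal{I}$ is an integer $N$ such that (i) $(i,j,k)\in\mathcal{I}$ whenever $i+j+k\le -N$ and $\max\{i,j,k\}=0$; (ii) $(i,j,k)\notin\mathcal{I}$ whenever $i+j+k\le -N-3$ and $\max\{i,j,k\}<0$. For $(i,j,k)\in\mathcal{I}$ let $r_a(i,j,k)=\{(i,j,k),(i,j-1,k),(i,j,k-1),(i,j-1,k-1)\}$,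 $r_b(i,j,k)=\{(i,j,k),(i-1,j,k),(i,j,k-1),(i-1,j,k-1)\}$, $r_c(i,j,k)=\{(i,j,k),(i-1,j,k),(i,j-1,k),(i-1,j-1,k)\}$; a rhombus is such a set contained in $\mathcal{I}$. Long edges: $e_a(i,j,k)=\{(i,j-1,k),(i,j,k-1)\}$, $e_b(i,j,k)=\{(i-1,j,k),(i,j,k-1)\}$, $e_c(i,j,k)=\{(i-1,j,k),(i,j-1,k)\}$; short edges: $e'_a(i,j,k)=\{(i,j,k),(i,j-1,k-1)\}$, $e'_b(i,j,k)=\{(i,j,k),(i-1,j,k-1)\}$, $e'_c(i,j,k)=\{(i,j,k),(i-1,j-1,k)\}$ (for $r_a,r_b,r_c$ respectively). $\mathcal{G}$ is the graph on $\mathcal{I}$ whose edges are the long and short edges of all rhombi. An $\mathcal{I}$-grove within radius $N$ is a subgraph $G\subseteq\mathcal{G}$ with: vertex set all of $\mathcal{I}$; for every rhombus exactly one of its two edges in $G$; for every rhombus all of whose vertices satisfy $i+j+k<-N$, its short edge in $G$; and every component of $G$ contains exactly one of the following sets, each of which lies in some component: $\{(0,p,q),(p,0,q)\}$, $\{(p,q,0),(0,q,p)\}$, $\{(q,0,p),(q,p,0)\}$ for $0>p>q$, $p+q\in\{-N-1,-N-2\}$; $\{(0,p,p),(p,0,p),(p,p,0)\}$ for $2p\in\{-N-1,-N-2\}$; $\{(0,0,q)\},\{(0,q,0)\},\{(q,0,0)\}$ for $q\le -N-1$. *)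

(* Defs.v *)
From Stdlib Require Import Relation_Operators.
From mathcomp Require Import all_boot all_order all_algebra finmap.
From mathcomp Require Import boolp classical_sets functions cardinality fsbigop.

Set Implicit Arguments.
Unset Strict Implicit.
Unset Printing Implicit Defensive.

Import Order.TTheory GRing.Theory Num.Theory.

Local Open Scope classical_set_scope.
Local Open Scope ring_scope.

(** ** Simple graphs on a possibly infinite vertex set *)

Record graph (V : Type) := Graph {
  vertices : set V;
  edges : set (set V);
  edges_pair : forall e, edges e ->
    exists v w, [/\ vertices v, vertices w, v <> w & e = [set v; w]]
}.

Definition subgraph (V : Type) (G H : graph V) : Prop :=
  vertices G `<=` vertices H /\ edges G `<=` edges H.

(* [fset_set] sends infinite sets to the empty one, so this is the degree only
   at vertices of finite degree; the graphs below are locally finite. *)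
Definition deg (V : Type) (G : graph V) (v : V) : nat :=
  #|` fset_set [set e | edges G e /\ e v]|.

Definition adj (V : Type) (G : graph V) (v w : V) : Prop := edges G [set v; w].

Definition component (V : Type) (G : graph V) (K : set V) : Prop :=
  exists2 v, vertices G v & K = [set w | clos_refl_trans V (adj G) v w].

(** ** Initial conditions *)

Definition Z3 : Type := (int * int * int)%type.

Definition cone (v : Z3) : set Z3 :=
  let: (i, j, k) := v in
  [set w | let: (i', j', k') := w in [/\ i' <= i, j' <= j & k' <= k]].

Definition order_ideal (L : set Z3) : Prop :=
  forall v, L v -> cone v `<=` L.

Definition initial (L : set Z3) : set Z3 :=
  [set v | L v /\ let: (i, j, k) := v in (~` L) (i + 1, j + 1, k + 1)].

Definition height (v : Z3) : int := let: (i, j, k) := v in i + j + k.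

Definition max3 (v : Z3) : int :=
  let: (i, j, k) := v in Num.max i (Num.max j k).

Definition cutoff (I : set Z3) (N : int) : Prop :=
  (forall v, height v <= - N -> max3 v = 0 -> I v) /\
  (forall v, height v <= - N - 3 -> max3 v < 0 -> ~ I v).

(** ** Rhombi and their edges *)

Variant axis := axis_a | axis_b | axis_c.

Definition rhombus (x : axis) (v : Z3) : set Z3 :=
  let: (i, j, k) := v in
  match x with
  | axis_a => [set (i, j, k); (i, j - 1, k); (i, j, k - 1); (i, j - 1, k - 1)]
  | axis_b => [set (i, j, k); (i - 1, j, k); (i, j, k - 1); (i - 1, j, k - 1)]
  | axis_c => [set (i, j, k); (i - 1, j, k); (i, j - 1, k); (i - 1, j - 1, k)]
  end.

Definition long_edge (x : axis) (v : Z3) : set Z3 :=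
  let: (i, j, k) := v in
  match x with
  | axis_a => [set (i, j - 1, k); (i, j, k - 1)]
  | axis_b => [set (i - 1, j, k); (i, j, k - 1)]
  | axis_c => [set (i - 1, j, k); (i, j - 1, k)]
  end.

Definition short_edge (x : axis) (v : Z3) : set Z3 :=
  let: (i, j, k) := v in
  match x with
  | axis_a => [set (i, j, k); (i, j - 1, k - 1)]
  | axis_b => [set (i, j, k); (i - 1, j, k - 1)]
  | axis_c => [set (i, j, k); (i - 1, j - 1, k)]
  end.

Definition rhombus_edges (I : set Z3) : set (set Z3) :=
  [set e | exists x v, rhombus x v `<=` I /\
                       (e = long_edge x v \/ e = short_edge x v)].

Lemma rhombus_edges_pair (I : set Z3) (e : set Z3) : rhombus_edges I e ->
  exists v w, [/\ I v, I w, v <> w & e = [set v; w]].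
Proof.
have neq1 (z : int) : z - 1 <> z.
  by move=> h; have := oner_neq0 int; rewrite -oppr_eq0 -(addKr z (-1)) h addNr eqxx.
move=> [x [[[i j] k]]].
case: x => /= -[sub [] ->]; do 2 eexists; split; try reflexivity;
  try (by apply: sub => /=; tauto);
  by case=> *; solve [apply: neq1; eassumption | apply: neq1; apply: esym; eassumption].
Qed.

Definition rhombus_graph (I : set Z3) : graph Z3 :=
  Graph (@rhombus_edges_pair I).

(** ** Groves *)

Variant boundary_set (N : int) : set (set Z3) :=
  | boundary_pair_c p q of p < 0 & q < p & p + q = - N - 1 \/ p + q = - N - 2 :
      boundary_set N [set (0, p, q); (p, 0, q)]
  | boundary_pair_b p q of p < 0 & q < p & p + q = - N - 1 \/ p + q = - N - 2 :
      boundary_set N [set (p, q, 0); (0, q, p)]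
  | boundary_pair_a p q of p < 0 & q < p & p + q = - N - 1 \/ p + q = - N - 2 :
      boundary_set N [set (q, 0, p); (q, p, 0)]
  | boundary_triple p of 2 * p = - N - 1 \/ 2 * p = - N - 2 :
      boundary_set N [set (0, p, p); (p, 0, p); (p, p, 0)]
  | boundary_single_c q of q <= - N - 1 : boundary_set N [set (0, 0, q)]
  | boundary_single_b q of q <= - N - 1 : boundary_set N [set (0, q, 0)]
  | boundary_single_a q of q <= - N - 1 : boundary_set N [set (q, 0, 0)].

Record grove (I : set Z3) (N : int) (G : graph Z3) : Prop := {
  grove_subgraph : subgraph G (rhombus_graph I);
  grove_vertices : vertices G = I;
  grove_rhombus : forall x v, rhombus x v `<=` I ->
    (edges G (long_edge x v) /\ ~ edges G (short_edge x v)) \/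
    (~ edges G (long_edge x v) /\ edges G (short_edge x v));
  grove_outside : forall x v, rhombus x v `<=` I ->
    (forall w, rhombus x v w -> height w < - N) -> edges G (short_edge x v);
  grove_component : forall K, component G K ->
    exists! B, boundary_set N B /\ B `<=` K;
  grove_boundary : forall B, boundary_set N B ->
    exists2 K, component G K & B `<=` K
}.

(* Main.v *)
Require Import Defs.
From mathcomp Require Import all_boot all_order all_algebra finmap.
From mathcomp Require Import boolp classical_sets functions cardinality fsbigop.
From mathcomp Require Import zify ring.
Import Order.TTheory GRing.Theory Num.Theory.
Local Open Scope classical_set_scope.
Local Open Scope ring_scope.

(* Write chi for the indicator of L, l_x(u) for the indicator of the long edge
   of the rhombus r_x(u) being in G, and D_a, D_b, D_c for the forward
   differences.  Since each rhombus contributes exactly one of its two edges,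
   deg v - 2 = - D_a D_b D_c chi - D_b D_c l_a - D_a D_c l_b - D_a D_b l_c at
   every vertex v of the grove, and the right-hand side vanishes at every other
   point.  Summed over a large box it telescopes to its corners and edges; chi
   and l_x are known far away, so only the sum of l_a over the line
   j = j0, k = k0 survives, and there r_a(i0, j0, k0) is the only rhombus. *)

(** * An edge determines its rhombus and its kind *)

Lemma set2_inj {T : Type} {a b c d : T} :
  [set a; b] = [set c; d] -> a = c /\ b = d \/ a = d /\ b = c.
Proof.
move=> E.
have [Ec Ed] : [set a; b] c /\ [set a; b] d by rewrite E /=; tauto.
have [Ea Eb] : [set c; d] a /\ [set c; d] b by rewrite -E /=; tauto.
by move: Ea Eb Ec Ed => /= [->|->] [->|->] [] h1 [] h2; subst; tauto.
Qed.

Lemma long_edge_inj x u y w :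
  long_edge x u = long_edge y w -> x = y /\ u = w.
Proof.
case: u w => [[i j] k] [[i' j'] k'].
case: x; case: y => /= /set2_inj [] [[E1 E2 E3] [E4 E5 E6]]; try (exfalso; lia);
  (split; first done); by congr (_, _, _); lia.
Qed.

Lemma short_edge_inj x u y w :
  short_edge x u = short_edge y w -> x = y /\ u = w.
Proof.
case: u w => [[i j] k] [[i' j'] k'].
case: x; case: y => /= /set2_inj [] [[E1 E2 E3] [E4 E5 E6]]; try (exfalso; lia);
  (split; first done); by congr (_, _, _); lia.
Qed.

(** The two ends of a long edge have equal height, those of a short edge heights differing by 2. *)
Lemma long_edge_neq_short_edge x u y w : long_edge x u <> short_edge y w.
Proof.
case: u w => [[i j] k] [[i' j'] k'].
by case: x; case: y => /= /set2_inj [] [[E1 E2 E3] [E4 E5 E6]]; lia.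
Qed.

Lemma rhombus_edges_long I x u :
  rhombus_edges I (long_edge x u) -> rhombus x u `<=` I.
Proof.
move=> [y [w [sub [/long_edge_inj[-> ->]//|/long_edge_neq_short_edge[]]]]].
Qed.

Lemma rhombus_edges_short I x u :
  rhombus_edges I (short_edge x u) -> rhombus x u `<=` I.
Proof.
move=> [y [w [sub [/esym/long_edge_neq_short_edge[]|/short_edge_inj[-> ->]//]]]].
Qed.

(** * Degrees as sums of indicators *)

Definition indic (P : Prop) : int := nat_of_bool `[< P >].

Lemma indicT {P : Prop} : P -> indic P = 1.
Proof. by move=> h; rewrite /indic asboolT. Qed.

Lemma indicF {P : Prop} : ~ P -> indic P = 0.
Proof. by move=> h; rewrite /indic asboolF. Qed.

Lemma eq_indic {P Q : Prop} : (P <-> Q) -> indic P = indic Q.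
Proof. by move=> /propext ->. Qed.

(* Axis by axis: two vertices joined to [v] by short edges, then two by long
   ones. *)
Definition neighbours (v : Z3) : seq Z3 :=
  let: (i, j, k) := v in
  [:: (i, j - 1, k - 1); (i, j + 1, k + 1); (i, j + 1, k - 1); (i, j - 1, k + 1);
      (i - 1, j, k - 1); (i + 1, j, k + 1); (i + 1, j, k - 1); (i - 1, j, k + 1);
      (i - 1, j - 1, k); (i + 1, j + 1, k); (i + 1, j - 1, k); (i - 1, j + 1, k)].

Lemma edge_neighbour I v w : rhombus_edges I [set v; w] -> w \in neighbours v.
Proof.
case: v w => [[i j] k] [[i' j'] k'].
move=> [x [[[a b] c] [_ E]]].
suff: [\/ [/\ i' = i, (j' = j + 1 \/ j' = j - 1) & (k' = k + 1 \/ k' = k - 1)],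
          [/\ j' = j, (i' = i + 1 \/ i' = i - 1) & (k' = k + 1 \/ k' = k - 1)] |
          [/\ k' = k, (i' = i + 1 \/ i' = i - 1) & (j' = j + 1 \/ j' = j - 1)]].
  by case=> -[-> [] -> [] ->]; rewrite !inE !eqxx ?orbT.
by case: E; case: x => /= /set2_inj [] [[E1 E2 E3] [E4 E5 E6]];
  [constructor 1|constructor 1|constructor 2|constructor 2|
   constructor 3|constructor 3|
   constructor 1|constructor 1|constructor 2|constructor 2|
   constructor 3|constructor 3]; split; lia.
Qed.

Lemma neighbours_uniq v : uniq (v :: neighbours v).
Proof.
case: v => [[i j] k]; rewrite /= !inE !xpair_eqE.
lia.
Qed.

(** An edge at [v] is determined by its other end, which [edge_neighbour] places in a list without
    repetition. So the edges at [v] form a finite set, and [fset_set] in [deg] takes its genuine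
    value. *)
Lemma deg_neighbours {I : set Z3} {G : graph Z3} (v : Z3) :
  edges G `<=` rhombus_edges I ->
  (deg G v)%:Z = \sum_(w <- neighbours v) indic (adj G v w).
Proof.
move=> GI.
have Nu := neighbours_uniq v.
pose s := [seq ([set v; w] : set Z3) | w <- neighbours v & `[< adj G v w >]].
have su : uniq s.
  rewrite map_inj_in_uniq; first by apply: filter_uniq; case/andP: Nu.
  by move=> a b _ _ /set2_inj[[_ ->]|[-> <-]].
have Es : [set e | edges G e /\ e v] = [set` s].
  apply/seteqP; split=> e /=.
    move=> [Ge ev]; have [a [b [_ _ ab ee]]] := edges_pair Ge.
    have [w Ew] : exists w, e = [set v; w].
      move: ev; rewrite ee => -[->|->]; first by exists b.
      by exists a; rewrite setUC.
    apply/mapP; exists w => //; rewrite mem_filter; apply/andP; split.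
      by apply/asboolP; rewrite /adj -Ew.
    by apply: (@edge_neighbour I); apply: GI; rewrite -Ew.
  by move=> /mapP[w]; rewrite mem_filter => /andP[/asboolP h _] ->; split=> //; left.
rewrite /deg Es.
have -> : [set` s] = [set` [fset e in s]%fset] by apply/seteqP; split=> e /=; rewrite inE.
rewrite set_fsetK card_fseq undup_id // size_map size_filter -sum1_count.
by rewrite big_mkcond /= raddf_sum /=; apply: eq_bigr => w _; rewrite /indic; case: asbool.
Qed.

(** * Rhombi in [initial L] in terms of [L] *)

Lemma order_ideal_le {L : set Z3} : order_ideal L ->
  forall i j k i' j' k' : int, L (i, j, k) ->
  i' <= i -> j' <= j -> k' <= k -> L (i', j', k').
Proof. by move=> hL i j k i' j' k' /hL sub *; apply: sub. Qed.

(** The point in question is the lowest vertex of the rhombus shifted by (1,1,1). The shifts of the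
    other vertices lie above it, so they avoid [L] as soon as it does. *)
Lemma rhombus_initial_top {L : set Z3} x i j k : order_ideal L ->
  initial L (i, j, k) ->
  rhombus x (i, j, k) `<=` initial L <->
  ~ L (match x with
       | axis_a => (i + 1, j, k) | axis_b => (i, j + 1, k) | axis_c => (i, j, k + 1)
       end).
Proof.
move=> /order_ideal_le le [Lv Uv]; split=> [sub Lx|Ux w].
  case: x sub Lx => sub Lx.
  - have [_] : initial L (i, j - 1, k - 1) by apply: sub => /=; tauto.
    by rewrite !subrK; apply.
  - have [_] : initial L (i - 1, j, k - 1) by apply: sub => /=; tauto.
    by rewrite !subrK; apply.
  - have [_] : initial L (i - 1, j - 1, k) by apply: sub => /=; tauto.
    by rewrite !subrK; apply.
by case: x Ux => /= Ux [[[->|->]|->]|->]; rewrite /initial /=;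
  (split; [apply: le Lv _ _ _; lia | move=> h; apply: Ux; apply: le h _ _ _; lia]).
Qed.

(** Top vertex of the rhombus whose lowest vertex is [v]: the other end of the short edge going up
    from [v]. *)
Definition opposite (x : axis) (v : Z3) : Z3 :=
  let: (i, j, k) := v in
  match x with
  | axis_a => (i, j + 1, k + 1)
  | axis_b => (i + 1, j, k + 1)
  | axis_c => (i + 1, j + 1, k)
  end.

(** All vertices lie between [v] and [opposite x v]: the upper bound puts them in [L], and the lower
    bound keeps their shifts by (1,1,1) outside [L]. *)
Lemma rhombus_initial_bottom {L : set Z3} x v : order_ideal L ->
  initial L v ->
  rhombus x (opposite x v) `<=` initial L <-> L (opposite x v).
Proof.
case: v => [[i j] k] /order_ideal_le le [Lv Uv]; split=> [sub|Lx w].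
  by case: x sub => sub; have [] := sub _ (or_introl (or_introl (or_introl erefl))).
by case: x Lx => /= Lx [[[->|->]|->]|->]; rewrite /initial /=; split;
  (try (apply: le Lx _ _ _; lia)); move=> h; apply: Uv; apply: le h _ _ _; lia.
Qed.

Lemma grove_edgesP {I : set Z3} {N : int} {G : graph Z3} : grove I N G ->
  edges G `<=` rhombus_edges I.
Proof. by case=> -[]. Qed.

(** Eliminates short edges: a rhombus in [I] has exactly one of its edges in [G], and any other
    rhombus has neither. *)
Lemma indic_short_edge {I : set Z3} {N : int} {G : graph Z3} x u :
  grove I N G ->
  indic (edges G (short_edge x u)) =
    indic (rhombus x u `<=` I) - indic (edges G (long_edge x u)).
Proof.
move=> hG; have [h|h] := pselect (rhombus x u `<=` I).
  rewrite (indicT h); have [[l s]|[l s]] := grove_rhombus hG h.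
    by rewrite (indicT l) (indicF s).
  by rewrite (indicF l) (indicT s).
rewrite !indicF ?subrr // => /(grove_edgesP hG).
  by move/rhombus_edges_long.
by move/rhombus_edges_short.
Qed.

(** * The local degree formula and where it vanishes *)

(** Defined at every point, in or out of the grove, so that it can be summed over full boxes. *)
Definition excess (L : set Z3) (G : graph Z3) (v : Z3) : int :=
  let: (i, j, k) := v in
  let chi i j k := indic (L (i, j, k)) in
  let l x i j k := indic (edges G (long_edge x (i, j, k))) in
  (chi i j k - chi (i + 1) j k - chi i (j + 1) k - chi i j (k + 1)
   + chi i (j + 1) (k + 1) + chi (i + 1) j (k + 1) + chi (i + 1) (j + 1) k
   - chi (i + 1) (j + 1) (k + 1))
  - (l axis_a i (j + 1) (k + 1) - l axis_a i j (k + 1)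
     - l axis_a i (j + 1) k + l axis_a i j k)
  - (l axis_b (i + 1) j (k + 1) - l axis_b i j (k + 1)
     - l axis_b (i + 1) j k + l axis_b i j k)
  - (l axis_c (i + 1) (j + 1) k - l axis_c i (j + 1) k
     - l axis_c (i + 1) j k + l axis_c i j k).

Lemma deg_excess {L : set Z3} {N : int} {G : graph Z3} v :
  order_ideal L -> grove (initial L) N G -> initial L v ->
  (deg G v)%:Z - 2 = excess L G v.
Proof.
move=> hL hG Iv; rewrite (deg_neighbours v (grove_edgesP hG)).
have S x : indic (edges G (short_edge x v)) = indic (rhombus x v `<=` initial L)
    - indic (edges G (long_edge x v)) by exact: indic_short_edge hG.
have S' x : indic (edges G (short_edge x (opposite x v))) = indic (L (opposite x v))
    - indic (edges G (long_edge x (opposite x v))).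
  by rewrite (indic_short_edge _ _ hG) (eq_indic (rhombus_initial_bottom x v hL Iv)).
case: v Iv S S' => [[i j] k] Iv S S'.
have neg P : indic (~ P) = 1 - indic P.
  by rewrite /indic asbool_neg; case: asbool.
have T x := eq_indic (rhombus_initial_top x i j k hL Iv).
have [Lv Uv] := Iv.
(* The three upper rhombi with top [v] contribute a constant 3; after subtracting 2, the remaining 1
   is [chi] at [v] minus [chi] at its shift by (1,1,1). *)
rewrite /= !big_cons big_nil /excess (indicT Lv) (indicF Uv) /adj.
move: (S axis_a) (S axis_b) (S axis_c) (S' axis_a) (S' axis_b) (S' axis_c).
rewrite !T !neg /= !addrK.
(* [adj] lists [v] first, while in these six edges the definitions list it second. *)
have C w : [set (i, j, k); w] = [set w; (i, j, k)] by rewrite setUC.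
rewrite (C (i, j + 1, k + 1)) (C (i + 1, j, k + 1)) (C (i + 1, j + 1, k)).
rewrite (C (i, j - 1, k + 1)) (C (i - 1, j, k + 1)) (C (i - 1, j + 1, k)).
by do 6!move=> ->; ring.
Qed.

(** The top vertex has the largest height in its rhombus; were it below [- N], [grove_outside] would
    force the short edge. *)
Lemma long_edge_coords {L : set Z3} {N : int} {G : graph Z3} x (i j k : int) :
  L `<=` cone (0, 0, 0) -> grove (initial L) N G ->
  edges G (long_edge x (i, j, k)) ->
  [/\ i <= 0, j <= 0, k <= 0, - N <= i + j + k & rhombus x (i, j, k) `<=` initial L].
Proof.
move=> hL0 hG l; have sub := rhombus_edges_long _ _ _ (grove_edgesP hG _ l).
have Iv : initial L (i, j, k) by apply: sub; case: x {l} => /=; tauto.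
have [i0 j0 k0] := hL0 _ Iv.1.
have [h|h] := lerP (- N) (i + j + k); first by [].
have [[_ ns]|[]//] := grove_rhombus hG sub.
exfalso; apply/ns/(grove_outside hG sub).
by case: x {l sub ns} => -[[i' j'] k'] /= [[[|]|]|] [-> -> ->]; lia.
Qed.

(** Every long-edge term belongs to a rhombus containing [v], so all of them vanish. The eight
    values of [chi] are all 0 if [v] is outside [L], and otherwise all 1, since the shift of [v] by
    (1,1,1) is then in [L]. *)
Lemma excess_notin_initial {L : set Z3} {N : int} {G : graph Z3} v :
  order_ideal L -> L `<=` cone (0, 0, 0) -> grove (initial L) N G ->
  ~ initial L v -> excess L G v = 0.
Proof.
case: v => [[i j] k] /order_ideal_le le hL0 hG nI.
have l0 x i' j' k' : rhombus x (i', j', k') (i, j, k) ->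
    indic (edges G (long_edge x (i', j', k'))) = 0.
  move=> r; apply: indicF => /(long_edge_coords _ _ _ _ hL0 hG)[_ _ _ _ sub].
  exact: nI (sub _ r).
rewrite /excess !l0 /= ?addrK; try tauto.
have [Lv|nL] := pselect (L (i, j, k)).
  have Lt : L (i + 1, j + 1, k + 1) by apply: contrapT => nt; apply: nI.
  by rewrite !indicT //; apply: le Lt _ _ _; lia.
by rewrite !indicF // => h; apply: nL; apply: le h _ _ _; lia.
Qed.

(** If a coordinate is less than [A], it and its successor are both at most [A]. There [L] agrees
    with the cone at the origin, so [chi] does not change in that direction, and heights below [- N]
    exclude long edges. *)
Lemma excess_far {L : set Z3} {N A : int} {G : graph Z3} (i j k : int) :
  order_ideal L -> L `<=` cone (0, 0, 0) -> grove (initial L) N G ->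
 A <= 0 -> A < - N -> (forall v, (~` L `&` cone (0, 0, 0)) v ->
              let: (i, j, k) := v in [/\ A < i, A < j & A < k]) ->
  [\/ i < A, j < A | k < A] -> excess L G (i, j, k) = 0.
Proof.
move=> hL hL0 hG A0 AN far h.
have chiE (a b c : int) : [\/ a <= A, b <= A | c <= A] ->
    indic (L (a, b, c)) = (nat_of_bool [&& a <= 0, b <= 0 & c <= 0])%:Z.
  move=> abc; case: (boolP [&& _, _ & _]) => [/and3P[a0 b0 c0]|n0].
    rewrite indicT //; apply: contrapT => nL.
    by have /= [] := far (a, b, c) (conj nL (And3 a0 b0 c0)); case: abc; lia.
  by rewrite indicF // => /hL0 /and3P; apply/negP.
have l0 x (a b c : int) : [\/ a <= A, b <= A | c <= A] ->
    indic (edges G (long_edge x (a, b, c))) = 0.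
  by move=> abc; rewrite indicF // => /(long_edge_coords _ _ _ _ hL0 hG)[]; case: abc; lia.
have le0 (a : int) : a <= A -> (a <= 0) = true by lia.
rewrite /excess !l0 ?chiE; try by case: h => h; (do ?[by constructor 1; lia
  | by constructor 2; lia | by constructor 3; lia]).
case: h => h.
- by rewrite (le0 i) ?(le0 (i + 1)) /=; [ring | lia | lia].
- by rewrite (le0 j) ?(le0 (j + 1)) /= ?andbT; [ring | lia | lia].
- by rewrite (le0 k) ?(le0 (k + 1)) /= ?andbT; [ring | lia | lia].
Qed.

(** * Telescoping over integer intervals *)

(** The half-open interval from [A] to [B] when [A <= B]; the absolute value makes it nonempty when
    [B < A] too, hence the order hypotheses below. *)
Definition int_range (A B : int) : seq int :=
  [seq A + n%:Z | n <- index_iota 0 `|B - A|%N].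

Lemma mem_int_range (A B x : int) : (x \in int_range A B) = (A <= x < A + `|B - A|).
Proof.
apply/mapP/idP => [[n]|h]; first by rewrite mem_index_iota => h ->; lia.
by exists `|x - A|%N; rewrite ?mem_index_iota; lia.
Qed.

Lemma int_range_uniq A B : uniq (int_range A B).
Proof. by rewrite map_inj_uniq ?iota_uniq // => m n; lia. Qed.

Lemma telescope_int_range (f : int -> int) A B : A <= B ->
  \sum_(x <- int_range A B) (f (x + 1) - f x) = f B - f A.
Proof.
move=> AB; rewrite big_map.
rewrite (telescope_sumr_eq (fun n => f (A + n%:Z))) //.
  by congr (f _ - f _); lia.
by move=> n _; congr (f _ - f _); lia.
Qed.

Lemma telescope_int_range2 (f : int -> int -> int) A B A' B' : A <= B -> A' <= B' ->
  \sum_(x <- int_range A B) \sum_(y <- int_range A' B')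
    (f (x + 1) (y + 1) - f x (y + 1) - f (x + 1) y + f x y) =
  f B B' - f A B' - f B A' + f A A'.
Proof.
move=> AB AB'.
rewrite (eq_bigr (fun x => (f (x + 1) B' - f (x + 1) A') - (f x B' - f x A'))).
  by rewrite (telescope_int_range (fun x => f x B' - f x A')) //; ring.
move=> x _; rewrite -!(telescope_int_range (f _)) // -sumrB.
by apply: eq_bigr => y _; ring.
Qed.

Lemma telescope_int_range3 (f : int -> int -> int -> int) A B A' B' A'' B'' :
  A <= B -> A' <= B' -> A'' <= B'' ->
  \sum_(x <- int_range A B) \sum_(y <- int_range A' B') \sum_(z <- int_range A'' B'')
    (f x y z - f (x + 1) y z - f x (y + 1) z - f x y (z + 1)
     + f x (y + 1) (z + 1) + f (x + 1) y (z + 1) + f (x + 1) (y + 1) z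
     - f (x + 1) (y + 1) (z + 1)) =
  f A A' A'' - f B A' A'' - f A B' A'' - f A A' B''
     + f A B' B'' + f B A' B'' + f B B' A'' - f B B' B''.
Proof.
move=> AB AB' AB''.
(* Minus the mixed second difference of [f x] over the corners of the rectangle in the last two
   coordinates. *)
pose g x := f x A' B'' + f x B' A'' - f x B' B'' - f x A' A''.
transitivity (g B - g A); last by rewrite /g; ring.
rewrite -(telescope_int_range g) //; apply: eq_bigr => x _.
pose h y z := f x y z - f (x + 1) y z.
transitivity (h B' B'' - h A' B'' - h B' A'' + h A' A''); last by rewrite /h /g; ring.
rewrite -(telescope_int_range2 h) //; apply: eq_bigr => y _; apply: eq_bigr => z _.
by rewrite /h; ring.
Qed.

(** * Finite boxes of lattice points *)

Lemma finite_lower_bound (X : set Z3) : finite_set X ->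
  exists A : int, forall v, X v -> let: (i, j, k) := v in [/\ A < i, A < j & A < k].
Proof.
case/finite_seqP => s ->; elim: s => [|[[i j] k] s [A IH]]; first by exists 0.
exists (Num.min A (Num.min i (Num.min j k) - 1)) => v /=; rewrite inE => /orP[/eqP->|].
  by split; lia.
by move=> /IH; case: v => [[i' j'] k'] [] *; split; lia.
Qed.

Definition int_box (A B A' B' A'' B'' : int) : seq Z3 :=
  [seq (xy, z) | xy <- [seq (x, y) | x <- int_range A B, y <- int_range A' B'],
                 z <- int_range A'' B''].

Lemma int_box_uniq A B A' B' A'' B'' : uniq (int_box A B A' B' A'' B'').
Proof.
by do !(apply: allpairs_uniq; rewrite ?int_range_uniq //); move=> [? ?] [? ?].
Qed.

Lemma mem_int_box A B A' B' A'' B'' (i j k : int) :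
  ((i, j, k) \in int_box A B A' B' A'' B'') =
  [&& i \in int_range A B, j \in int_range A' B' & k \in int_range A'' B''].
Proof.
apply/allpairsP/and3P => [[[_ z] /= [/allpairsP[[x y] /= [xi yi ->]] zi [-> -> ->]]]//|[xi yi zi]].
by exists ((i, j), k); split=> //=; apply: allpairs_f.
Qed.

(** * Summation over a large box and over the region of the theorem *)

(** The corners of [chi] at first coordinate 1 are 0, and the four at [A] are 1 with cancelling
    signs. The corners for axes b and c have first coordinate 1 or [A], where no long edge lies in
    [G]. *)
Lemma sum_excess_int_box {L : set Z3} {N A : int} {G : graph Z3} (i0 j0 k0 : int) :
  order_ideal L -> L `<=` cone (0, 0, 0) -> grove (initial L) N G ->
  A <= 0 -> A < - N -> (forall v, (~` L `&` cone (0, 0, 0)) v ->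
              let: (i, j, k) := v in [/\ A < i, A < j & A < k]) ->
  A <= j0 -> A <= k0 -> A <= i0 ->
  rhombus axis_a (i0, j0, k0) `<=` initial L ->
  \sum_(v <- int_box A 1 A j0 A k0) excess L G v =
  - indic (edges G (long_edge axis_a (i0, j0, k0))).
Proof.
move=> hL hL0 hG A0 AN far Aj Ak Ai hr.
have Iv : initial L (i0, j0, k0) by apply: hr; rewrite /=; tauto.
have [i00 j00 k00] := hL0 _ Iv.1.
pose chi i j k := indic (L (i, j, k)).
pose l x i j k := indic (edges G (long_edge x (i, j, k))).
have A1 : A <= 1 by lia.
have chi0 j k : chi 1 j k = 0 by rewrite /chi indicF // => /hL0 [].
have chi1 j k : j <= 0 -> k <= 0 -> chi A j k = 1.
  move=> jle kle; rewrite /chi indicT //; apply: contrapT => nL.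
  by have /= [] := far (A, j, k) (conj nL (And3 A0 jle kle)); rewrite ltxx.
have lA x i j k : [\/ i <= A, j <= A | k <= A] -> l x i j k = 0.
  by move=> abc; rewrite /l indicF // => /(long_edge_coords _ _ _ _ hL0 hG)[]; case: abc; lia.
have lA1 x j k : l x A j k = 0 by apply: lA; constructor 1.
have lA2 x i k : l x i A k = 0 by apply: lA; constructor 2.
have lA3 x i j : l x i j A = 0 by apply: lA; constructor 3.
have l1 x j k : l x 1 j k = 0.
  by rewrite /l indicF // => /(long_edge_coords _ _ _ _ hL0 hG)[].
(* Two rhombi of [initial L] on this line cannot coexist: the lowest vertex of the one with smaller
   [i] needs [(i + 1, j0, k0)] outside [L], yet that point lies below the top vertex of the
   other. *)
have suml : \sum_(i <- int_range A 1) l axis_a i j0 k0 = l axis_a i0 j0 k0.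
  rewrite (bigD1_seq i0) ?int_range_uniq ?mem_int_range //=; last by lia.
  rewrite big1 ?addr0 // => i ne; rewrite /l indicF //.
  move=> /(long_edge_coords _ _ _ _ hL0 hG)[_ _ _ _ sub].
  have [Li Ui] : initial L (i, j0 - 1, k0 - 1) by apply: sub; rewrite /=; tauto.
  have [Li0 Ui0] : initial L (i0, j0 - 1, k0 - 1) by apply: hr; rewrite /=; tauto.
  have [Li' _] : initial L (i, j0, k0) by apply: sub; rewrite /=; tauto.
  rewrite !subrK in Ui Ui0;
  have [ii0|ii0|ii0] := ltrgtP i i0.
  - by apply: Ui; apply: (order_ideal_le hL _ _ _ _ _ _ Iv.1); lia.
  - by apply: Ui0; apply: (order_ideal_le hL _ _ _ _ _ _ Li'); lia.
  - by rewrite ii0 eqxx in ne.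
rewrite /int_box !big_allpairs.
pose dl x i j k :=
  match x with
  | axis_a => l x i (j + 1) (k + 1) - l x i j (k + 1) - l x i (j + 1) k + l x i j k
  | axis_b => l x (i + 1) j (k + 1) - l x i j (k + 1) - l x (i + 1) j k + l x i j k
  | axis_c => l x (i + 1) (j + 1) k - l x i (j + 1) k - l x (i + 1) j k + l x i j k
  end.
(* For axes b and c the sums are exchanged so that the two differenced coordinates are innermost. *)
transitivity (
  \sum_(i <- int_range A 1) \sum_(j <- int_range A j0) \sum_(k <- int_range A k0)
    (chi i j k - chi (i + 1) j k - chi i (j + 1) k - chi i j (k + 1)
     + chi i (j + 1) (k + 1) + chi (i + 1) j (k + 1) + chi (i + 1) (j + 1) k
     - chi (i + 1) (j + 1) (k + 1))
  - \sum_(i <- int_range A 1) \sum_(j <- int_range A j0) \sum_(k <- int_range A k0)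
      dl axis_a i j k
  - \sum_(j <- int_range A j0) \sum_(i <- int_range A 1) \sum_(k <- int_range A k0)
      dl axis_b i j k
  - \sum_(k <- int_range A k0) \sum_(i <- int_range A 1) \sum_(j <- int_range A j0)
      dl axis_c i j k).
  rewrite [X in _ - X - _]exchange_big [X in _ - X]exchange_big -!sumrB.
  apply: eq_bigr => i _; rewrite [X in _ - X]exchange_big -!sumrB.
  apply: eq_bigr => j _; rewrite -!sumrB; apply: eq_bigr => k _.
  by rewrite /excess /dl.
rewrite (telescope_int_range3 chi) // !chi0 !chi1 //.
rewrite [X in _ - X - _ - _](_ : _ = l axis_a i0 j0 k0); last first.
  rewrite -suml; apply: eq_bigr => i _; rewrite /dl.
  rewrite (telescope_int_range2 (l axis_a i)) // ?lA1 ?lA2 ?lA3.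
  by ring.
rewrite [X in _ - X - _](_ : _ = 0); last first.
  rewrite big1 // => j _; rewrite /dl.
  rewrite (telescope_int_range2 (fun i k => l axis_b i j k)) // !l1 ?lA1 ?lA2 ?lA3.
  by ring.
rewrite [X in _ - X](_ : _ = 0); last first.
  rewrite big1 // => k _; rewrite /dl.
  rewrite (telescope_int_range2 (fun i j => l axis_c i j k)) // !l1 ?lA1 ?lA2 ?lA3.
  by ring.
by rewrite /l; ring.
Qed.

Theorem theorem3 (L : set Z3) (i0 j0 k0 : int)
    (hL : order_ideal L)
    (hL0 : L `<=` cone (0, 0, 0))
    (hU : finite_set (~` L `&` cone (0, 0, 0)))
    (hr : rhombus axis_a (i0, j0, k0) `<=` initial L)
    (N : int) (hN : cutoff (initial L) N)
    (G : graph Z3) (hG : grove (initial L) N G) :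
  let D := [set v : Z3 | initial L v /\
                         let: (i, j, k) := v in j < j0 /\ k < k0] in
  let S : int := \sum_(v \in D) ((deg G v)%:Z - 2) in
  [/\ finite_set [set v | D v /\ (deg G v)%:Z - 2 <> 0],
      edges G (long_edge axis_a (i0, j0, k0)) -> S = -1
    & ~ edges G (long_edge axis_a (i0, j0, k0)) -> S = 0].
Proof.
move=> D S.
have Iv : initial L (i0, j0, k0) by apply: hr; rewrite /=; tauto.
have [i00 j00 k00] := hL0 _ Iv.1.
have [A' farA'] := finite_lower_bound _ hU.
(* [A] lies at or below the bound for the missing points of the cone, strictly below [- N], and at
   or below [i0], [j0], [k0], so that the ranges are well ordered and the first one contains
   [i0]. *)
pose A := Num.min A' (Num.min (- N - 1) (Num.min i0 (Num.min j0 k0))).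
have far v : (~` L `&` cone (0, 0, 0)) v ->
    let: (i, j, k) := v in [/\ A < i, A < j & A < k].
  by move=> /farA'; case: v => [[i j] k] [] *; split; rewrite /A; lia.
have [A0 AN Ai Aj Ak] : [/\ A <= 0, A < - N, A <= i0, A <= j0 & A <= k0].
  by rewrite /A; split; lia.
set box := int_box A 1 A j0 A k0.
have outside v : D v -> v \notin box -> (deg G v)%:Z - 2 = 0.
  case: v => [[i j] k] [Ivijk [jj kk]]; have [i1 j1 k1] := hL0 _ Ivijk.1.
  rewrite (deg_excess _ hL hG Ivijk) mem_int_box !mem_int_range => nbox.
  apply: (excess_far _ _ _ hL hL0 hG A0 AN far).
  have [?|?] := ltrP i A; first by constructor 1.
  have [?|?] := ltrP j A; first by constructor 2.
  by constructor 3; lia.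
(* The box already enforces [j < j0] and [k < k0], so its points outside [D] are outside
   [initial L]. *)
have inside v : v \in box -> ~ D v -> excess L G v = 0.
  case: v => [[i j] k]; rewrite mem_int_box !mem_int_range => hbox nD.
  apply: (excess_notin_initial _ hL hL0 hG) => Ivijk.
  by apply: nD; split=> //; lia.
have SE : S = - indic (edges G (long_edge axis_a (i0, j0, k0))).
  rewrite -(sum_excess_int_box _ _ _ hL hL0 hG A0 AN far Aj Ak Ai hr) -/box.
  (* By [outside], the box points in [D] carry every nonzero term; by [inside], the remaining box
     points can be added with value 0. *)
  rewrite /S (fsbigE [seq v <- box | v \in D]); first last.
  - by move=> v Dv; rewrite mem_filter mem_set //=; exact: outside.
  - by move=> v /=; rewrite mem_filter => /andP[/set_mem].
  - by rewrite filter_uniq // int_box_uniq.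
  rewrite big_filter_cond big_mkcond /= !big_seq; apply: eq_bigr => v vbox.
  rewrite andbb; case: ifPn => [/set_mem Dv|/negP nD].
    exact: deg_excess hL hG Dv.1.
  by rewrite inside // => Dv; apply/nD/mem_set.
split.
- apply: (sub_finite_set (B := [set` box])); last exact: finite_seq.
  by move=> v [Dv ne]; apply: contrapT => /negP nb; apply/ne/outside.
- by move=> h; rewrite SE (indicT h).
- by move=> h; rewrite SE (indicF h) oppr0.
Qed.
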